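(* Let $n\ge 4$ and $\alpha\in\{0,1\}$. Then (1) $|\mathcal{PSC}_n^{\alpha,1}|=2^{n-2}$; (2) $|\mathcal{PSC}_n^{1,0}|=2^{n-2}$ if $n$ is odd, and $|\mathcal{PSC}_n^{1,0}|=2^{n-2}-2^{\frac{n-2}{2}}$ if $n$ is even; (3) $|\mathcal{PSC}_n^{0,0}|=2^{n-2}-2^{\lfloor\frac{n-1}{2}\rfloor}$.
   Context: For $n\ge 3$, let $C_n$ be the set of $n\times n$ real matrices $A$ whose first $n-1$ rows are fixed, row $i$ ($1\le i\le n-1$) having a single entry $1$ in column $i+1$ and zeros elsewhere, and whose last row is $(a_{n,1},\dots,a_{n,n})$ with every $a_{n,j}\in\{0,1\}$ (companion matrices with $(0,1)$ last row). For $A\in C_n$ put $F(A)=A+A^T$ (a ''symmetric companion matrix''). For $\alpha,\mathbf e\in\{0,1\}$ let $C_n^{\alpha,\mathbf e}=\{F(A): A\in C_n,\ a_{n,1}=\alpha,\ a_{n,n}=\mathbf e\}$ and let $\mathcal{PSC}_n^{\alpha,\mathbf e}$ be the set of primitive matrices in $C_n^{\alpha,\mathbf e}$. A nonnegative square matrix $B$ is primitive if $B^k$ is entrywise positive for some positive integer $k$. *)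

(* Defs.v *)
From HB Require Import structures.
From mathcomp Require Import all_boot all_order all_algebra.
From mathcomp Require Import boolp classical_sets functions cardinality reals.
Set Implicit Arguments.
Unset Strict Implicit.
Unset Printing Implicit Defensive.
Import Order.TTheory GRing.Theory Num.Theory.
Local Open Scope classical_set_scope.
Local Open Scope ring_scope.

(* Indices are 0-based: row or column k is the ordinal of value k-1,
   so the last row or column is the ordinal i with i.+1 = n. *)

Definition companion01 (R : realType) (n : nat) : set 'M[R]_n :=
  [set A : 'M[R]_n | (forall i j : 'I_n, (i.+1 < n)%N ->
              A i j = ((j : nat) == i.+1)%:R)
        /\ (forall i j : 'I_n, i.+1 = n -> A i j = 0 \/ A i j = 1)].

Definition symcomp (R : realType) (n : nat) (A : 'M[R]_n) : 'M[R]_n :=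
  A + A^T.

(* The parameters alpha, e in {0,1} are booleans, read as numbers through the
   coercions bool >-> nat and %:R; they are the values of the corner entries
   a_{n,1} and a_{n,n}. *)
Definition SC (R : realType) (n : nat) (alpha e : bool) : set 'M[R]_n :=
  @symcomp R n @` [set A : 'M[R]_n | companion01 A
    /\ (forall i j : 'I_n, i.+1 = n -> (j : nat) = 0%N -> A i j = alpha%:R)
    /\ (forall i j : 'I_n, i.+1 = n -> j.+1 = n -> A i j = e%:R)].

Definition primitive_mx (R : realType) (n : nat) (B : 'M[R]_n) : Prop :=
  (forall i j, 0 <= B i j) /\
  exists k : nat, (0 < k)%N /\ forall i j, 0 < (B ^+ k) i j.

Definition PSC (R : realType) (n : nat) (alpha e : bool) : set 'M[R]_n :=
  [set B : 'M[R]_n | @SC R n alpha e B /\ primitive_mx B].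

Arguments SC R n alpha e : clear implicits.
Arguments PSC R n alpha e : clear implicits.

(* Main.v *)
(* The graph of A + A^T is a path through all vertices with chords from its last
   vertex, so it is connected, and A + A^T is primitive iff this graph is not
   bipartite.  The path has only one 2-colouring, by parity, so this happens iff
   the last vertex is joined to a vertex of its own parity (itself included).
   Since A + A^T determines the n-2 free entries of the last row, one counts the
   subsets of n-2 points that are not contained in the other parity class. *)
Require Import Defs.
From HB Require Import structures.
From mathcomp Require Import all_boot all_order all_algebra.
From mathcomp Require Import boolp classical_sets functions cardinality reals.
From mathcomp Require Import finmap zify.
Set Implicit Arguments.
Unset Strict Implicit.
Unset Printing Implicit Defensive.
Import Order.TTheory GRing.Theory Num.Theory.
Local Open Scope classical_set_scope.
Local Open Scope card_scope.
Local Open Scope ring_scope.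

Section NonnegativePowers.
Variables (R : realType) (n : nat) (B : 'M[R]_n).
Hypothesis B_ge0 : forall i j, 0 <= B i j.

Lemma mxpow_ge0 k i j : 0 <= (B ^+ k) i j.
Proof.
elim: k i j => [|k IHk] i j; first by rewrite expr0 mxE ler0n.
by rewrite exprS mxE sumr_ge0 // => t _; rewrite mulr_ge0.
Qed.

Lemma mxpowD_gt0 k l i j t :
  0 < (B ^+ k) i j -> 0 < (B ^+ l) j t -> 0 < (B ^+ (k + l)) i t.
Proof.
move=> ij jt; rewrite exprD mxE (bigD1 j) //= ltr_pwDl ?mulr_gt0 //.
by apply: sumr_ge0 => s _; rewrite mulr_ge0 ?mxpow_ge0.
Qed.

Hypothesis path_gt0 :
  forall i j : 'I_n, (j = i.+1 :> nat) \/ (i = j.+1 :> nat) -> 0 < B i j.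

(** Walk along the path towards [j]; the surplus of steps is even by parity and is spent going back
    and forth along one edge, which exists as [1 < n]. *)
Lemma mxpow_path_gt0 k (i j : 'I_n) : (1 < n)%N ->
  (i <= j + k)%N -> (j <= i + k)%N -> odd k = odd i (+) odd j ->
  0 < (B ^+ k) i j.
Proof.
move=> n_gt1; elim: k i => [|k IHk] i ij ji par.
  have -> : i = j by apply: val_inj => /=; lia.
  by rewrite expr0 mxE eqxx ltr01.
have in_n := ltn_ord i; have jn := ltn_ord j.
have step (t : nat) : (t < n)%N -> (t = i.+1 \/ i = t.+1 :> nat) ->
    (t <= j + k)%N -> (j <= t + k)%N -> 0 < (B ^+ k.+1) i j.
  move=> tn it tj jt; rewrite -add1n.
  apply: (mxpowD_gt0 (j := Ordinal tn)); first by rewrite expr1; exact: path_gt0.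
  by apply: IHk => //=; lia.
case: (ltngtP i j) => cmp.
- by apply: (step i.+1); lia.
- by apply: (step i.-1); lia.
(* Already at [j] with steps left: move to the right neighbour, or to the left one from the end of
   the path. *)
- have [lt|ge] := ltnP i.+1 n; first by apply: (step i.+1); lia.
  by apply: (step i.-1); lia.
Qed.

Lemma odd_chord_primitive (c d : 'I_n) : (1 < n)%N ->
  0 < B d c -> odd c = odd d -> primitive_mx B.
Proof.
move=> n_gt1 dc par; split => //; exists n.*2.+2; split => // i j.
have in_n := ltn_ord i; have jn := ltn_ord j.
have cn := ltn_ord c; have dn := ltn_ord d.
have [ij|ij] := eqVneq (odd i) (odd j).
  by apply: mxpow_path_gt0 => //; lia.
(* One truncated difference vanishes, so [a] is the distance from [i] to [d]. The chord keeps parity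
   while using one step, which makes an even total length fit endpoints of opposite parity; the
   remaining length exceeds [n], enough to reach [j]. *)
pose a := ((i - d) + (d - i))%N.
have -> : n.*2.+2 = (a + (1 + (n.*2.+1 - a)))%N by rewrite /a; lia.
apply: (mxpowD_gt0 (j := d)); first by apply: mxpow_path_gt0; rewrite /a; lia.
apply: (mxpowD_gt0 (j := c)); first by rewrite expr1.
by apply: mxpow_path_gt0; rewrite /a; lia.
Qed.

End NonnegativePowers.

(** Every edge switches the parity class, so the endpoints of a walk fix the parity of its
    length. *)
Lemma bipartite_mxpow (R : realType) n (B : 'M[R]_n) :
  (forall i j : 'I_n, odd i = odd j -> B i j = 0) ->
  forall k (i j : 'I_n), odd k != odd i (+) odd j -> (B ^+ k) i j = 0.
Proof.
move=> bip; elim=> [|k IHk] i j.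
  by rewrite expr0 mxE; case: (eqVneq i j) => // ->; rewrite addbb.
move=> par; rewrite exprS mxE big1 // => t _.
have [it|it] := eqVneq (odd i) (odd t); first by rewrite bip ?mul0r.
rewrite IHk ?mulr0 //; move: par it => /=.
by case: (odd i); case: (odd j); case: (odd t); case: (odd k).
Qed.

Lemma bipartite_not_primitive (R : realType) n (B : 'M[R]_n) : (1 < n)%N ->
  (forall i j : 'I_n, odd i = odd j -> B i j = 0) -> ~ primitive_mx B.
Proof.
move=> n_gt1 bip [_ [k [_ pos]]].
pose i0 := Ordinal (ltnW n_gt1); pose i1 := Ordinal n_gt1.
(* An odd power vanishes at (0,0), an even one at (0,1). *)
case k_odd : (odd k).
  by have := pos i0 i0; rewrite (bipartite_mxpow bip) ?k_odd // ltxx.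
by have := pos i0 i1; rewrite (bipartite_mxpow bip) ?k_odd // ltxx.
Qed.

Section LastRow.
Variables (R : realType) (m : nat) (alpha e : bool).
Implicit Type S : {set 'I_m}.

(* The last row (alpha, 1_S(0), ..., 1_S(m-1), e), indexed from 0. *)
Definition last_row S (j : nat) : bool :=
  if j is j'.+1 then if insub j' is Some k then k \in S else e else alpha.
Arguments last_row : simpl never.

Lemma last_row_mid S (k : 'I_m) : last_row S k.+1 = (k \in S).
Proof. by rewrite /last_row valK. Qed.

Lemma last_row_max S : last_row S m.+1 = e.
Proof. by rewrite /last_row insubN // ltnn. Qed.

Definition companion_of S : 'M[R]_m.+2 :=
  \matrix_(i, j) (if (i.+1 < m.+2)%N then j == i.+1 :> nat else last_row S j)%:R.

Lemma symcomp_companion_of S (i j : 'I_m.+2) :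
  symcomp (companion_of S) i j =
    ((if (i.+1 < m.+2)%N then j == i.+1 :> nat else last_row S j) +
     (if (j.+1 < m.+2)%N then i == j.+1 :> nat else last_row S i))%N%:R.
Proof. by rewrite !mxE natrD. Qed.

Lemma symcomp_companion_inj :
  injective (fun S => symcomp (companion_of S)).
Proof.
move=> S T /matrixP eqST; apply/setP => k.
have kn := ltn_ord k.
have km : (k.+1 < m.+2)%N by lia.
have := eqST ord_max (Ordinal km).
rewrite !symcomp_companion_of /= !ltnn !last_row_mid !last_row_max => /eqP.
(* The contribution of the transpose is the same for [S] and [T], hence cancels. *)
by rewrite eqr_nat eqn_add2r; do 2!case: (_ \in _).
Qed.

Lemma SC_range :
  SC R m.+2 alpha e = range (fun S => symcomp (companion_of S)).
Proof.
apply/seteqP; split => [B [A [[top bot] [corner0 corner1]] <-]|B [S _ <-]].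
  (* Free entry [k] sits in column [k.+1], since column 0 holds the corner [alpha]. *)
  exists (finset (fun k : 'I_m => A ord_max (inord k.+1) == 1)) => //.
  congr symcomp; apply/matrixP => i j; rewrite mxE.
  have in_n := ltn_ord i; have jn := ltn_ord j.
  case: ifP => i_lt; first by rewrite top.
  have iE : i = ord_max by apply: val_inj => /=; lia.
  rewrite {}iE {i in_n i_lt}.
  have [j0|j_gt0] := posnP j; first by rewrite j0 /= corner0.
  have [jE|j_lt] := eqVneq (j : nat) m.+1.
    by rewrite jE last_row_max corner1 ?jE.
  have km : (j.-1 < m)%N by lia.
  have -> : (j : nat) = (Ordinal km).+1 by rewrite /= prednK.
  rewrite last_row_mid inE /= prednK // inord_val.
  by case: (bot ord_max j erefl) => ->; rewrite ?eqxx // eq_sym oner_eq0.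
exists (companion_of S) => //; split; last split.
- split=> i j hi; first by rewrite mxE hi.
  by rewrite mxE hi ltnn; case: last_row; [right|left].
- by move=> i j hi j0; rewrite mxE hi ltnn j0.
- move=> i j hi hj; rewrite mxE hi ltnn (_ : nat_of_ord j = m.+1) //.
    by rewrite last_row_max.
  by lia.
Qed.

(* The chord from the last vertex to j closes an odd cycle with the path
   exactly when j has the parity of the last vertex; j = m.+1 is the loop. *)
Lemma primitive_symcomp S :
  primitive_mx (symcomp (companion_of S)) <->
  exists2 j, (j < m.+2)%N & last_row S j && (odd j == odd m.+1).
Proof.
split=> [prim|[c cn /andP[rc /eqP par]]].
  apply: contrapT => none; apply: bipartite_not_primitive prim => // i j par.
  have none' (t : 'I_m.+2) : odd t = odd m.+1 -> last_row S t = false.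
    by move=> ht; apply: contra_notF none => rt; exists t; rewrite // rt ht eqxx.
  have in_n := ltn_ord i; have jn := ltn_ord j.
  rewrite symcomp_companion_of.
  have ij : (i == j.+1 :> nat) = false by apply/eqP => ij; lia.
  have ji : (j == i.+1 :> nat) = false by apply/eqP => ji; lia.
  have last_i : (i.+1 < m.+2)%N = false -> odd i = odd m.+1 by lia.
  have last_j : (j.+1 < m.+2)%N = false -> odd j = odd m.+1 by lia.
  rewrite ij ji; case: ifP => [_|/last_i hi]; case: ifP => [_|/last_j hj] //.
  - by rewrite none' // par.
  - by rewrite none' // -par.
  - by rewrite !none'.
apply: (@odd_chord_primitive _ _ _ _ _ (Ordinal cn) ord_max) => //.
- by move=> i j; rewrite symcomp_companion_of ler0n.
- move=> i j ij; rewrite symcomp_companion_of ltr0n.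
  have in_n := ltn_ord i; have jn := ltn_ord j.
  case: ij => ij.
    have -> : (i.+1 < m.+2)%N by lia.
    by rewrite ij eqxx.
  have -> : (j.+1 < m.+2)%N by lia.
  by rewrite ij eqxx addn1.
- by rewrite symcomp_companion_of /= ltnn rc ltr0n.
Qed.

Lemma card_PSC (P : {set {set 'I_m}}) :
  (forall S, reflect
    (exists2 j, (j < m.+2)%N & last_row S j && (odd j == odd m.+1))
    (S \in P)) ->
  PSC R m.+2 alpha e #= `I_#|P|.
Proof.
move=> PE.
have -> : PSC R m.+2 alpha e =
    (fun S => symcomp (companion_of S)) @` [set` P].
  rewrite /PSC SC_range; apply/seteqP; split=> B /=.
    by move=> [[S _ <-] /primitive_symcomp/PE SP]; exists S.
  by move=> [S /PE/primitive_symcomp SP <-]; split; first by exists S.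
apply: card_eq_trans (inj_card_eq _) _.
  by move=> S T _ _ /symcomp_companion_inj.
have -> : [set` P] = [set` [fset S in enum P]%fset].
  by apply/seteqP; split=> S /=; rewrite inE mem_enum.
by apply/card_eq_fsetP; rewrite card_fseq undup_id ?enum_uniq // -cardE.
Qed.

End LastRow.

Lemma card_ord_other_parity m :
  #|[set k : 'I_m | odd k != odd m]%SET| = uphalf m.
Proof.
(* Counting from the top turns the condition into evenness, which no longer mentions [m], so that
   induction on [m] applies. *)
rewrite cardsE -sum1_card (reindex_inj rev_ord_inj) /= big_mkcond /=.
rewrite (eq_bigr (fun k : 'I_m => (~~ odd k : nat))) => [|k _].
  elim: m => [|m IHm]; first by rewrite big_ord0.
  by rewrite big_ord_recr /= IHm; lia.
by have km := ltn_ord k; rewrite unfold_in /=; case: ifP; lia.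
Qed.

Lemma card_subsets_ord m : #|[set: {set 'I_m}]%SET| = (2 ^ m)%N.
Proof. by rewrite -powersetT card_powerset cardsT card_ord. Qed.

(** The complement is the powerset of the other parity class. Element [k] stands for column [k.+1]
    and the last vertex is [m.+1], so parities are compared with [m]. *)
Lemma card_meets_parity m :
  #|[set S : {set 'I_m} | [exists k in S, odd k == odd m]]%SET| =
  (2 ^ m - 2 ^ uphalf m)%N.
Proof.
rewrite -card_ord_other_parity -card_powerset -card_subsets_ord.
rewrite -cardsDS ?finset.subsetT //.
apply: eq_card => S; rewrite !inE andbT; apply/exists_inP/subsetPn => -[k].
  by move=> kS kp; exists k; rewrite // inE negbK.
by move=> kS; rewrite inE negbK; exists k.
Qed.

(* X #= `I_m says that the set X has exactly m elements. *)
Theorem theorem1 (R : realType) (n : nat) (alpha : bool) (hn : (4 <= n)%N) :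
  (PSC R n alpha true #= `I_(2 ^ (n - 2))%N)
  /\ ((odd n -> PSC R n true false #= `I_(2 ^ (n - 2))%N)
      /\ (~~ odd n ->
          PSC R n true false #= `I_(2 ^ (n - 2) - 2 ^ ((n - 2) %/ 2))%N))
  /\ (PSC R n false false #= `I_(2 ^ (n - 2) - 2 ^ ((n - 1) %/ 2))%N).
Proof.
case: n hn => [|[|m]] // _; rewrite subn2 subn1 /= !divn2 negbK.
(* Without a loop, and with the corner entry either zero or joining vertices of opposite parity,
   only the free entries can close an odd cycle. *)
have chord alpha' : alpha' && odd m = false ->
    PSC R m.+2 alpha' false #= `I_(2 ^ m - 2 ^ uphalf m)%N.
  move=> no0; rewrite -card_meets_parity; apply: card_PSC => S; rewrite inE.
  apply: (iffP exists_inP) => [[k kS kp]|[[|j] jn /andP[rj jp]]].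
  - exists k.+1; first by have := ltn_ord k; lia.
    by rewrite last_row_mid kS /=; lia.
  - by move: no0 jp; rewrite (rj : alpha') /= => ->.
  - have [jm|jm] := ltnP j m.
      exists (Ordinal jm); last by move: jp => /=; lia.
      by rewrite -(last_row_mid alpha' false).
    by move: rj; rewrite (_ : j = m) ?last_row_max //; lia.
split; last split; [|split|] => [||m_even|].
(* The loop at the last vertex makes every [S] count. *)
- rewrite -card_subsets_ord; apply: card_PSC => S; rewrite inE; apply: ReflectT.
  by exists m.+1; rewrite ?last_row_max ?eqxx.
(* Here the last vertex is even, so its chord to vertex 0 makes every [S] count. *)
- move=> m_odd; rewrite -card_subsets_ord; apply: card_PSC => S; rewrite inE.
  by apply: ReflectT; exists 0%N => //=; rewrite m_odd.
- have -> : m./2 = uphalf m by lia.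
  by apply: chord; apply: negbTE.
- exact: chord.
Qed.
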